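(* Let $I\subset\mathbb{R}$ be an interval with interior $I^{\circ}$, let $f:I\to\mathbb{R}$ be twice differentiable on $I^{\circ}$, let $a,b\in I^{\circ}$ with $a<b$, and suppose $f''\in L_1[a,b]$. Suppose $|f''|$ is convex on $[a,b]$. Then $$\left|\frac{1}{b-a}\int_a^b f(x)\,dx-f\left(\frac{a+b}{2}\right)\right|\le\frac{(b-a)^2}{48}\bigl(|f''(a)|+|f''(b)|\bigr).$$ If in addition $f'(a)=f'(b)$, then $$\left|\frac{1}{b-a}\int_a^b f(x)\,dx-\frac{f(a)+f(b)}{2}\right|\le\frac{(b-a)^2}{48}\bigl(|f''(a)|+|f''(b)|\bigr).$$
   Context: $L_1[a,b]$ denotes the space of Lebesgue integrable functions on $[a,b]$. *)

(* Defs.v *)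
From mathcomp Require Export all_boot all_order all_algebra.
From mathcomp Require Export all_classical all_reals all_analysis.

(* Main.v *)
Require Import Defs.
From mathcomp Require Import all_boot all_order all_algebra.
From mathcomp Require Import all_classical all_reals all_analysis.
From mathcomp Require Import ring lra.

Set Implicit Arguments.
Unset Strict Implicit.

Import Order.TTheory GRing.Theory Num.Theory.
Import numFieldNormedType.Exports.
Local Open Scope ring_scope.
Local Open Scope classical_set_scope.

(** The second derivative need not be continuous, so the error terms are
bounded by convexity rather than by integrating by parts against it. Write
[h = b - a], [m = (a + b) / 2], [A = |f''(a)|], [B = |f''(b)|]. Convexity of
[|f''|] puts it below its chord [L] on [a, b] ([convex_function_le_chord]).
Let [p] be a cubic with [p'' = L]. Then [p + f] and [p - f] both have a
nonnegative second derivative, so both lie above their tangents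
([tangent_le]); in other words the first order Taylor remainder of [f] at any
point [c] is bounded in absolute value by that of [p] ([taylor1_majorant]).

Integrating this bound ([Rintegral_taylor1_le]) gives both inequalities.

With [c = m] on [a, b], the linear term has integral zero, the left side is
the error of the midpoint rule for [f], and the right side is the same error
for [p], namely [h^3 (A + B) / 48].

For the trapezoidal rule, take [c = a] on [a, m] and [c = b] on [m, b]. The two
linear terms contribute [(f'(a) - f'(b)) h^2 / 8], which vanishes because
[f'(a) = f'(b)]; what remains of the left side is the error of the trapezoidal
rule. The corresponding quantity for [p] is
[\int p - h (p(a) + p(b)) / 2 + h^2 (p'(b) - p'(a)) / 8], that is half the
integral of [(x - m)^2 L(x)], again [h^3 (A + B) / 48].

Only the even part of [L] about [m] contributes, which is why the bounds
depend on [A + B] alone. *)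

(** * Tangent lines and Taylor remainders *)

Definition poly_evalE := (hornerXsubC, hornerD, hornerN, hornerZ, hornerM,
  hornerX, hornerC).

Lemma is_derive_within_continuous (R : realType) (g g1 : R -> R) (i : interval R) :
  {in i, forall x : R, is_derive x 1 g (g1 x)} -> {within [set` i], continuous g}.
Proof.
by move=> dg; apply: derivable_within_continuous => x xi; have [] := dg x xi.
Qed.

Lemma mean_value (R : realType) (g g1 : R -> R) (a b x y : R) :
  {in `[a, b]%R, forall z : R, is_derive z 1 g (g1 z)} ->
  a <= x -> x < y -> y <= b ->
  exists2 z, x < z < y & g y - g x = g1 z * (y - x).
Proof.
move=> dg ax xy yb.
have sub z : x <= z -> z <= y -> z \in `[a, b]%R.
  by move=> xz zy; rewrite in_itv/=; apply/andP; split; lra.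
have [] := @MVT R g g1 x y xy.
- by move=> z; rewrite in_itv/= => /andP[xz zy]; apply/dg/sub; exact: ltW.
- apply: (@is_derive_within_continuous _ _ g1) => z.
  by rewrite in_itv/= => /andP[xz zy]; apply/dg/sub.
- by move=> z; rewrite in_itv/= => xzy e; exists z.
Qed.

(** The mean value theorem is used twice: for [g1], to see that it is
nondecreasing, then for [g] between [c] and [x]. *)
Lemma tangent_le (R : realType) (g g1 g2 : R -> R) (a b : R) :
  {in `[a, b]%R, forall x : R, is_derive x 1 g (g1 x)} ->
  {in `[a, b]%R, forall x : R, is_derive x 1 g1 (g2 x)} ->
  {in `[a, b]%R, forall x, 0 <= g2 x} ->
  {in `[a, b]%R &, forall c x, g c + g1 c * (x - c) <= g x}.
Proof.
move=> dg dg1 g2_ge0 c x; rewrite !in_itv/= => /andP[ac cb] /andP[ax xb].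
have g1_nd y z : a <= y -> y < z -> z <= b -> g1 y <= g1 z.
  move=> ay yz zb; have [t /andP[yt tz] e] := mean_value dg1 ay yz zb.
  have : 0 <= g2 t by apply: g2_ge0; rewrite in_itv/=; apply/andP; split; lra.
  by move=> ?; rewrite -subr_ge0 e mulr_ge0// subr_ge0 ltW.
have [cx|xc|->] := ltgtP c x; last by rewrite subrr mulr0 addr0.
- have [t /andP[ct tx] e] := mean_value dg ac cx xb.
  have : g1 c <= g1 t by apply: g1_nd => //; lra.
  by nra.
- have [t /andP[xt tc] e] := mean_value dg ax xc cb.
  have : g1 t <= g1 c by apply: g1_nd => //; lra.
  by nra.
Qed.

(** A bound on the second derivative passes to the first order Taylor
remainder without any regularity of [f2]: [p + f] and [p - f] lie above their
tangents at [c]. *)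
Lemma taylor1_majorant (R : realType) (f f1 f2 : R -> R) (p : {poly R}) (a b : R) :
  {in `[a, b]%R, forall x : R, is_derive x 1 f (f1 x)} ->
  {in `[a, b]%R, forall x : R, is_derive x 1 f1 (f2 x)} ->
  {in `[a, b]%R, forall x, `|f2 x| <= p^`()^`().[x]} ->
  {in `[a, b]%R &, forall c x, `|f x - (f c + f1 c * (x - c))|
    <= p.[x] - (p.[c] + p^`().[c] * (x - c))}.
Proof.
move=> df df1 f2_le c x ci xi; rewrite ler_norml; apply/andP; split.
- have := @tangent_le R (horner p + f) (horner p^`() + f1)
    (horner p^`()^`() + f2) a b.
  move=> /(_ _ _ _ c x ci xi); rewrite !fctE/= => H.
  suff : p.[c] + f c + (p^`().[c] + f1 c) * (x - c) <= p.[x] + f x by lra.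
  apply: H => y yi.
  + by have := df y yi => ?; exact: is_deriveD.
  + by have := df1 y yi => ?; exact: is_deriveD.
  + by have := f2_le y yi; rewrite ler_norml => /andP[? ?]; lra.
- have := @tangent_le R (horner p - f) (horner p^`() - f1)
    (horner p^`()^`() - f2) a b.
  move=> /(_ _ _ _ c x ci xi); rewrite !fctE/= => H.
  suff : p.[c] - f c + (p^`().[c] - f1 c) * (x - c) <= p.[x] - f x by lra.
  apply: H => y yi.
  + by have := df y yi => ?; exact: is_deriveB.
  + by have := df1 y yi => ?; exact: is_deriveB.
  + by have := f2_le y yi; rewrite ler_norml => /andP[? ?]; lra.
Qed.

(** * Integrals of Taylor remainders *)

Section integrals.
Context {R : realType}.
Local Notation mu := (@lebesgue_measure R).

Lemma integrable_continuous_itvcc (f : R -> R) (a b : R) :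
  {within `[a, b], continuous f} -> mu.-integrable `[a, b] (EFin \o f).
Proof. by apply: continuous_compact_integrable; exact: segment_compact. Qed.

Lemma within_continuous_horner (p : {poly R}) (A : set R) :
  {within A, continuous (horner p)}.
Proof. by apply: continuous_subspaceT => x; exact: continuous_horner. Qed.

Lemma Rintegral_deriv_poly (q : {poly R}) (a b : R) : a < b ->
  \int[mu]_(x in `[a, b]) q^`().[x] = q.[b] - q.[a].
Proof.
move=> ab; rewrite /Rintegral (@continuous_FTC2 _ _ (horner q))//.
- exact: within_continuous_horner.
- split.
  + by move=> x _; have [] := is_derive_poly q x.
  + by apply: cvg_at_right_filter; exact: continuous_horner.
  + by apply: cvg_at_left_filter; exact: continuous_horner.
- by move=> x _; rewrite derive1E; have /@derive_val := is_derive_poly q x.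
Qed.

Lemma Rintegral_le_poly (f : R -> R) (q : {poly R}) (a b : R) : a < b ->
  {within `[a, b], continuous f} ->
  {in `[a, b]%R, forall x, f x <= q^`().[x]} ->
  \int[mu]_(x in `[a, b]) f x <= q.[b] - q.[a].
Proof.
move=> ab cf fq; rewrite -Rintegral_deriv_poly//; apply: le_Rintegral => //.
- exact: integrable_continuous_itvcc.
- by apply: integrable_continuous_itvcc; exact: within_continuous_horner.
Qed.

Lemma Rintegral_ge_poly (f : R -> R) (q : {poly R}) (a b : R) : a < b ->
  {within `[a, b], continuous f} ->
  {in `[a, b]%R, forall x, q^`().[x] <= f x} ->
  q.[b] - q.[a] <= \int[mu]_(x in `[a, b]) f x.
Proof.
move=> ab cf fq; rewrite -Rintegral_deriv_poly//; apply: le_Rintegral => //.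
- by apply: integrable_continuous_itvcc; exact: within_continuous_horner.
- exact: integrable_continuous_itvcc.
Qed.

Lemma Rintegral_itvcc_split (f : R -> R) (a m b : R) : a < m -> m < b ->
  {within `[a, b], continuous f} ->
  \int[mu]_(x in `[a, b]) f x =
  \int[mu]_(x in `[a, m]) f x + \int[mu]_(x in `[m, b]) f x.
Proof.
move=> am mb cf; have intf := integrable_continuous_itvcc cf.
rewrite -[X in _ + X]Rintegral_itv_obnd_cbnd.
  by rewrite -(Rintegral_itvB intf) ?bnd_simp ?ltW// addrC subrK.
apply: integrableS intf => //; apply: subset_itv; rewrite bnd_simp//.
exact: ltW.
Qed.

(** The integral over [u, v] of the estimate of [taylor1_majorant], applied to
the polynomial [q^`()]. The factor [((v - c) ^+ 2 - (u - c) ^+ 2) / 2] is the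
integral of [x - c]. Stating it through an antiderivative [q] makes the right
side a difference of values of polynomials. *)
Lemma Rintegral_taylor1_le (f f1 f2 : R -> R) (q : {poly R}) (u v c : R) :
  u < v -> c \in `[u, v]%R ->
  {in `[u, v]%R, forall x : R, is_derive x 1 f (f1 x)} ->
  {in `[u, v]%R, forall x : R, is_derive x 1 f1 (f2 x)} ->
  {in `[u, v]%R, forall x, `|f2 x| <= q^`()^`()^`().[x]} ->
  `|\int[mu]_(x in `[u, v]) f x
    - (f c * (v - u) + f1 c * (((v - c) ^+ 2 - (u - c) ^+ 2) / 2))|
  <= q.[v] - q.[u]
    - (q^`().[c] * (v - u) + q^`()^`().[c] * (((v - c) ^+ 2 - (u - c) ^+ 2) / 2)).
Proof.
move=> uv ci df df1 f2_le.
have cf := is_derive_within_continuous df.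
have maj := taylor1_majorant df df1 f2_le ci.
(* The antiderivative of [y + s (x - c)] that vanishes at [c]: adding it to
   [q] or subtracting [q] from it turns the bounds on [f] into derivatives of
   polynomials. *)
pose T (y s : R) : {poly R} := y *: ('X - c%:P) + (s / 2) *: ('X - c%:P) ^+ 2.
have TE y s x : (T y s).[x] = y * (x - c) + s / 2 * (x - c) ^+ 2.
  by rewrite /T !hornerE.
have T'E y s x : (T y s)^`().[x] = y + s * (x - c).
  by rewrite /T !(exprS, expr0, mulr1) !poly.derivE !poly_evalE; field.
clearbody T; rewrite ler_norml; apply/andP; split.
- have := @Rintegral_ge_poly f
    (T (f c + q^`().[c]) (f1 c + q^`()^`().[c]) - q) u v uv cf.
  rewrite !hornerD !hornerN !TE => H.
  suff /H : {in `[u, v]%R, forall x,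
    (T (f c + q^`().[c]) (f1 c + q^`()^`().[c]) - q)^`().[x] <= f x} by lra.
  move=> x xi; rewrite derivB hornerD hornerN T'E.
  by have := maj x xi; rewrite ler_norml => /andP[]; lra.
- have := @Rintegral_le_poly f
    (T (f c - q^`().[c]) (f1 c - q^`()^`().[c]) + q) u v uv cf.
  rewrite !hornerD !TE => H.
  suff /H : {in `[u, v]%R, forall x,
    f x <= (T (f c - q^`().[c]) (f1 c - q^`()^`().[c]) + q)^`().[x]} by lra.
  move=> x xi; rewrite poly.derivE hornerD T'E.
  by have := maj x xi; rewrite ler_norml => /andP[]; lra.
Qed.

End integrals.

(** * Midpoint and trapezoidal rules *)

(** The chord is written about the midpoint, so that its constant term is the
mean of the two end values and its linear term is odd about that point. *)
Lemma convex_function_le_chord (R : realType) (h : R -> R) (a b x : R) :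
  a < b -> convex_function `[a, b] h -> x \in `[a, b]%R ->
  h x <= (h a + h b) / 2 + (h b - h a) / (b - a) * (x - (a + b) / 2).
Proof.
move=> ab ch; rewrite in_itv/= => /andP[ax xb].
have ba0 : b - a != 0 by rewrite subr_eq0 gt_eqF.
(* [x] is the barycentre of [a] and [b] with weight [(b - x) / (b - a)] on [a]. *)
have t01 : 0 <= (b - x) / (b - a) <= 1.
  by rewrite ler_pdivlMr ?ler_pdivrMr ?mul0r ?mul1r; lra.
have /andP[t0 t1] := t01.
have := ch (Itv01 t0 t1) a b; rewrite !inE/= !in_itv/= !lexx !(ltW ab)//=.
move=> /(_ isT isT); rewrite [X in _ <= X]convRE/= /unstable.onem.
set y := conv _ _ _; have -> : y = x.
  suff : (b - x) / (b - a) * a + (1 - (b - x) / (b - a)) * b = x by [].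
  by field.
by move=> /le_trans; apply; rewrite le_eqVlt; apply/orP; left; apply/eqP; field.
Qed.

Theorem corollary2 (R : realType) (I : set R) (f : R -> R) (a b : R)
  (itvI : is_interval I)
  (df : forall x : R, I° x -> derivable f x 1)
  (ddf : forall x : R, I° x -> derivable f^`() x 1)
  (aI : I° a) (bI : I° b) (ab : a < b)
  (intddf : (@lebesgue_measure R).-integrable `[a, b] (EFin \o f^`(2)))
  (cvxddf : convex_function `[a, b] (fun x : R => `|f^`(2) x|)) :
  `|(b - a)^-1 * (\int[@lebesgue_measure R]_(x in `[a, b]) f x)
    - f ((a + b) / 2)|
    <= (b - a) ^+ 2 / 48 * (`|f^`(2) a| + `|f^`(2) b|)
  /\
  (f^`() a = f^`() b ->
   `|(b - a)^-1 * (\int[@lebesgue_measure R]_(x in `[a, b]) f x)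
     - (f a + f b) / 2|
    <= (b - a) ^+ 2 / 48 * (`|f^`(2) a| + `|f^`(2) b|)).
Proof.
(* The derivatives are available at [a] and [b] too, since these are interior
   points of [I]. *)
have II x : a <= x -> x <= b -> I° x.
  rewrite le_eqVlt => /predU1P[<-//|ax].
  rewrite le_eqVlt => /predU1P[->//|xb].
  suff : `]a, b[ `<=` I° by apply; rewrite /= in_itv/= ax xb.
  rewrite -open_subsetE; last exact: interval_open.
  move=> y; rewrite /= in_itv/= => /andP[ay yb].
  apply: itvI (interior_subset aI) (interior_subset bI) _ _.
  by rewrite !ltW.
pose m := (a + b) / 2.
have am : a < m by rewrite /m; lra.
have mb : m < b by rewrite /m; lra.
have d0 u v : a <= u -> v <= b ->
    {in `[u, v]%R, forall x : R, is_derive x 1 f (f^`() x)}.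
  move=> au vb x; rewrite in_itv/= => /andP[ux xv].
  by split; [apply/df/II; lra | rewrite derive1E].
have d1 u v : a <= u -> v <= b ->
    {in `[u, v]%R, forall x : R, is_derive x 1 f^`() (f^`(2) x)}.
  move=> au vb x; rewrite in_itv/= => /andP[ux xv].
  by split; [apply/ddf/II; lra | rewrite -derive1E].
set A := `|f^`(2) a|; set B := `|f^`(2) b|.
pose k := (B - A) / (b - a).
(* Chosen so that the third derivative of [q] is the chord of [|f''|]. *)
pose q : {poly R} := ((A + B) / 12) *: ('X - m%:P) ^+ 3
                     + (k / 24) *: ('X - m%:P) ^+ 4.
have q0E x : q.[x] = (A + B) / 12 * (x - m) ^+ 3 + k / 24 * (x - m) ^+ 4.
  by rewrite /q !hornerE.
have q1E x : q^`().[x] = (A + B) / 4 * (x - m) ^+ 2 + k / 6 * (x - m) ^+ 3.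
  by rewrite /q !(exprS, expr0, mulr1) !poly.derivE !poly_evalE; field.
have q2E x : q^`()^`().[x] = (A + B) / 2 * (x - m) + k / 2 * (x - m) ^+ 2.
  by rewrite /q !(exprS, expr0, mulr1) !poly.derivE !poly_evalE; field.
have q3E x : q^`()^`()^`().[x] = (A + B) / 2 + k * (x - m).
  by rewrite /q !(exprS, expr0, mulr1) !poly.derivE !poly_evalE; field.
have bound u v : a <= u -> v <= b ->
    {in `[u, v]%R, forall x, `|f^`(2) x| <= q^`()^`()^`().[x]}.
  move=> au vb x; rewrite in_itv/= => /andP[ux xv]; rewrite q3E.
  apply: (convex_function_le_chord ab cvxddf).
  by rewrite in_itv/=; apply/andP; split; lra.
have taylor u v c : a <= u -> u < v -> v <= b -> c \in `[u, v]%R -> _ :=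
  fun au uv vb ci => Rintegral_taylor1_le uv ci (d0 u v au vb)
   (d1 u v au vb) (bound u v au vb).
have scale J y : `|J - (b - a) * y| <= (b - a) ^+ 3 / 48 * (A + B) ->
    `|(b - a)^-1 * J - y| <= (b - a) ^+ 2 / 48 * (A + B).
  move=> H; have ba : 0 < b - a by rewrite subr_gt0.
  rewrite -(ler_pM2l ba) -[X in X * `|_|](gtr0_norm ba) -normrM.
  rewrite mulrBr mulVKf ?gt_eqF//; apply: le_trans H _.
  by rewrite le_eqVlt; apply/orP; left; apply/eqP; field.
split=> [|f'ab]; apply: scale.
- have := taylor a b m (lexx a) ab (lexx b).
  rewrite in_itv/= (ltW am) (ltW mb) => /(_ isT).
  by rewrite !q0E q1E q2E -/m !ler_norml /m => /andP[? ?]; apply/andP; split; lra.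
- rewrite (Rintegral_itvcc_split am mb); last first.
    exact: is_derive_within_continuous (d0 a b (lexx a) (lexx b)).
  have := taylor a m a (lexx a) am (ltW mb).
  have := taylor m b b (ltW am) mb (lexx b).
  rewrite !in_itv/= !lexx (ltW am) (ltW mb)/= => /(_ isT) + /(_ isT).
  rewrite !q0E !q1E !q2E !ler_norml f'ab /m => /andP[? ?] /andP[? ?].
  by apply/andP; split; lra.
Qed.
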